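(* For all $p\in\beta\mathbb{N}$ and all $q\in\beta\mathbb{N}\setminus\mathbb{N}$ we have $E_1(p,q)\neq q$. In particular, there are no $E_1$-idempotent ultrafilters in $\beta\mathbb{N}\setminus\mathbb{N}$, i.e. there is no $p\in\beta\mathbb{N}\setminus\mathbb{N}$ with $E_1(p,p)=p$.
   Context: $\mathbb{N}=\{1,2,\ldots\}$, and $\beta\mathbb{N}$ is the set of ultrafilters on $\mathbb{N}$; each $n\in\mathbb{N}$ is identified with the principal ultrafilter it generates, so $\mathbb{N}\subseteq\beta\mathbb{N}$ and $\beta\mathbb{N}\setminus\mathbb{N}$ is the set of nonprincipal ultrafilters. For $p,q\in\beta\mathbb{N}$, $E_1(p,q)\in\beta\mathbb{N}$ is the ultrafilter $$E_1(p,q)=\{A\subseteq\mathbb{N}\mid \{n\in\mathbb{N}\mid\{m\in\mathbb{N}\mid n^m\in A\}\in q\}\in p\}.$$ *)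

(* Defs.v *)
From mathcomp Require Import all_boot.
From mathcomp Require Import boolp classical_sets filter.

Set Implicit Arguments.
Unset Strict Implicit.
Unset Printing Implicit Defensive.

Local Open Scope classical_set_scope.

(* The naturals here start at 1; ssrnat's nat would add 0. *)
Definition posnat : Type := {n : nat | (0 < n)%N}.

Lemma exp_posnat_gt0 (n m : posnat) : (0 < val n ^ val m)%N.
Proof. by rewrite expn_gt0 (valP n). Qed.

Definition exp_posnat (n m : posnat) : posnat :=
  exist _ (val n ^ val m)%N (exp_posnat_gt0 n m).

Record betaN : Type := BetaN {
  betaN_sets : set_system posnat;
  betaN_ultra : UltraFilter betaN_sets
}.

Lemma betaN_inj (p q : betaN) : betaN_sets p = betaN_sets q -> p = q.
Proof.
case: p q => [F FU] [G GU] /= FG; move: FU GU; rewrite FG => FU GU.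
by congr BetaN; exact: Prop_irrelevance.
Qed.

Definition principal (n : posnat) : betaN :=
  BetaN (principal_filter_ultra n).

Definition betaN_minus_N : set betaN := ~` range principal.

Definition E1_sets (p q : betaN) : set_system posnat :=
  [set A | betaN_sets p [set n | betaN_sets q [set m | A (exp_posnat n m)]]].

Lemma E1_ultra (p q : betaN) : UltraFilter (E1_sets p q).
Proof.
have [pU qU] := (betaN_ultra p, betaN_ultra q).
have EP : ProperFilter (E1_sets p q).
  split.
    rewrite /E1_sets /= => pq0; apply: (@filter_not_empty _ (betaN_sets p)).
    apply: filterS pq0 => n /= q0.
    exact: (@filter_not_empty _ (betaN_sets q) _ q0).
  split.
  - by rewrite /E1_sets /=; apply: filterE => n; apply: filterE.
  - move=> A B; rewrite /E1_sets /= => pA pB.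
    by apply: filterS2 pA pB => n qA qB; apply: filterS2 qA qB.
  - move=> A B AB; rewrite /E1_sets /=; apply: filterS => n.
    by apply: filterS => m; exact: AB.
split=> // G GP EG; apply/seteqP; split=> // A GA.
rewrite /E1_sets /=.
have [//|pC] := in_ultra_setVsetC [set n | betaN_sets q [set m | A (exp_posnat n m)]] pU.
have GC : G (~` A).
  apply: EG; rewrite /E1_sets /=; apply: filterS pC => n /= nq.
  by have [//|] := in_ultra_setVsetC [set m | A (exp_posnat n m)] qU.
exfalso; apply: (@filter_not_empty _ G).
by rewrite -(setICr A); exact: filterI.
Qed.

Definition E1 (p q : betaN) : betaN := BetaN (E1_ultra p q).

(* Main.v *)
Require Import Defs.
From mathcomp Require Import all_boot.
From mathcomp Require Import boolp classical_sets filter.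
From mathcomp Require Import zify.

(** Let [level x] be the least height of a tower of twos exceeding [x]. If
    [2 <= n <= m] and [4 <= m], then [2 ^ m <= n ^ m <= 2 ^ (2 ^ m)], so passing
    from [m] to [n ^ m] raises the level by 1 or 2, hence changes it modulo 3.
    Colour the naturals by their level modulo 3 and take the colour class [A]
    that lies in [q]. As [q] is nonprincipal, for each [n >= 2] almost every [m]
    is in [A] and at least [n], so [n ^ m] is not in [A]; hence the complement
    of [A] is in [E1 p q], unless [p] is concentrated at [n = 1], in which case
    [E1 p q] is principal. *)

Local Open Scope classical_set_scope.

Definition tower (k : nat) : nat := iter k (expn 2) 0.

Lemma leq_tower : {homo tower : i j / i <= j}.
Proof. by apply: homo_leq leqnn leq_trans _ => k; exact/ltnW/ltn_expl. Qed.

Lemma tower_ge (k : nat) : k <= tower k.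
Proof. by elim: k => // k IHk; apply: leq_ltn_trans IHk _; exact: ltn_expl. Qed.

Lemma tower_unbounded (x : nat) : exists k, x < tower k.
Proof. by exists x.+1; exact: tower_ge. Qed.

Definition level (x : nat) : nat := ex_minn (tower_unbounded x).

(** Turns every comparison of levels below into a comparison with a tower. *)
Lemma level_leq (x k : nat) : (level x <= k) = (x < tower k).
Proof.
rewrite /level; case: ex_minnP => l xl lmin; apply/idP/idP; last exact: lmin.
by move=> /leq_tower; exact: leq_trans.
Qed.

Lemma sqrn_leq_exp2 (m : nat) : 4 <= m -> m ^ 2 <= 2 ^ m.
Proof.
elim: m => // m IHm; rewrite leq_eqVlt => /predU1P[<- //|m_ge4].
have {}IHm := IHm m_ge4; rewrite (expnS 2) mul2n -addnn.
by apply: leq_trans (leq_add IHm IHm); rewrite -!mulnn; nia.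
Qed.

(** Since [n <= m < 2 ^ m], the power is at most [2 ^ (m ^ 2)], and [m ^ 2 <= 2 ^ m] from 4 on. *)
Lemma expn_leq_exp2_exp2 (n m : nat) :
  n <= m -> 4 <= m -> n ^ m <= 2 ^ (2 ^ m).
Proof.
move=> nm m_ge4; apply: (@leq_trans ((2 ^ m) ^ m)).
  by rewrite leq_exp2r; [exact/(leq_trans nm)/ltnW/ltn_expl | lia].
by rewrite -expnM leq_exp2l // mulnn sqrn_leq_exp2.
Qed.

Lemma level_expn_gt (n m : nat) : 2 <= n -> level m < level (n ^ m).
Proof.
move=> n_ge2; rewrite ltnNge level_leq; apply/negP.
have nm_ge : 2 ^ m <= n ^ m by case: m => // m; rewrite leq_exp2r.
(* Nothing lies below [tower 0 = 0]. Otherwise [2 ^ m < 2 ^ tower k] would put [m] below [tower k],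
   hence at level at most [k]. *)
case lm: (level m) => [|k]; first by [].
rewrite [tower _]/= => /(leq_ltn_trans nm_ge); rewrite ltn_exp2l //.
by rewrite -level_leq lm ltnn.
Qed.

Lemma level_expn_leq (n m : nat) :
  n <= m -> 4 <= m -> level (n ^ m) <= level m + 2.
Proof.
move=> nm m_ge4; rewrite level_leq addn2 /=.
apply: leq_ltn_trans (expn_leq_exp2_exp2 _ _ nm m_ge4) _.
by rewrite !ltn_exp2l // -level_leq.
Qed.

Lemma level_expn_mod3 (n m : nat) : 2 <= n -> n <= m -> 4 <= m ->
  level (n ^ m) %% 3 <> level m %% 3.
Proof.
move=> n2 nm m4.
by have := level_expn_gt n m n2; have := level_expn_leq n m nm m4; lia.
Qed.

Lemma nonprincipal_setC1 (q : betaN) (n : posnat) :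
  betaN_minus_N q -> betaN_sets q (~` [set n]).
Proof.
move=> qN; have qU := betaN_ultra q.
have [qn|//] := in_ultra_setVsetC [set n] qU.
exfalso; apply: qN; exists n => //; apply: betaN_inj; symmetry.
(* Every set containing [n] includes [[set n]], so [q] extends the principal ultrafilter, which is
   maximal. *)
have nU := betaN_ultra (principal n); apply: max_filter => A An.
by apply: filterS qn => _ ->; exact: An.
Qed.

Lemma nonprincipal_ge (q : betaN) (k : nat) :
  betaN_minus_N q -> betaN_sets q [set m : posnat | k <= val m].
Proof.
move=> qN; have qU := betaN_ultra q.
elim: k => [|k IHk]; first exact: filterE.
have [k_gt0|] := ltnP 0 k; last first.
  by rewrite leqn0 => /eqP ->; apply: filterE => m; exact: (valP m).
apply: filterS2 IHk (nonprincipal_setC1 q (exist _ k k_gt0) qN) => m /= km mNk.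
rewrite ltn_neqAle km andbT; apply/eqP => kE.
by apply: mNk; exact/val_inj.
Qed.

Lemma ultra_fiber3 (q : betaN) (f : posnat -> nat) :
  exists i, betaN_sets q [set m | f m %% 3 = i].
Proof.
have qU := betaN_ultra q.
have [q0|q0] := in_ultra_setVsetC [set m | f m %% 3 = 0] qU; first by exists 0.
have [q1|q1] := in_ultra_setVsetC [set m | f m %% 3 = 1] qU; first by exists 1.
by exists 2; apply: filterS2 q0 q1 => m /=; lia.
Qed.

Lemma E1_neq (p q : betaN) : betaN_minus_N q -> E1 p q <> q.
Proof.
move=> qN Epq; have [pU qU] := (betaN_ultra p, betaN_ultra q).
have qE A : betaN_sets q A ->
    betaN_sets p [set n | betaN_sets q [set m | A (exp_posnat n m)]].
  by rewrite -{1}Epq.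
have [i qi] := ultra_fiber3 q (fun m => level (val m)).
(* Carried over to [n ^ m], the bound 2 excludes [n = 1], so no case split on [p] is needed. *)
have qA : betaN_sets q [set m | level (val m) %% 3 = i /\ 2 <= val m].
  by apply: filterS2 qi (nonprincipal_ge q 2 qN).
apply: (@filter_not_empty _ (betaN_sets p)).
apply: filterS (qE _ qA) => n /= qn.
apply: (@filter_not_empty _ (betaN_sets q)).
(* Here [n] is fixed, so the bound on [m] may depend on it. *)
apply: filterS3 qn qi (nonprincipal_ge q (maxn (val n) 4) qN) => m /=.
move=> [nmi nm2] mi; rewrite geq_max => /andP[nm m4].
apply: (level_expn_mod3 (val n) (val m)) => //; last by rewrite nmi mi.
rewrite ltnNge; apply/negP => n_le1.
have n1 : val n = 1 by have := valP n; lia.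
by move: nm2; rewrite n1 exp1n.
Qed.

Theorem theorem2p28 :
  (forall p q : betaN, betaN_minus_N q -> E1 p q <> q) /\
  ~ (exists p : betaN, betaN_minus_N p /\ E1 p p = p).
Proof.
split; first exact: E1_neq.
by case=> p [pN]; exact: E1_neq.
Qed.
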